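(* There are $2^{\aleph_0}$ distinct ages consisting of finite permutation graphs which are minimal prime.
   Context: Graphs are simple, undirected, loopless. A graph $G$ embeds in $G'$ if it is isomorphic to an induced subgraph of $G'$. A class of finite graphs is hereditary if it is closed under embedded graphs. $\mathrm{Age}(G)$ is the class of finite graphs, up to isomorphism, that embed in $G$; an age is a class of the form $\mathrm{Age}(G)$ for some graph $G$. A graph $(V,E)$ is a permutation graph if there is a total order $\le$ on $V$ and a permutation $\sigma$ of $V$ such that the edges are exactly the pairs $\{x,y\}$ whose order is reversed by $\sigma$. A module of $G=(V,E)$ is a set $A\subseteq V$ such that each $x\in V\setminus A$ is adjacent to all or to none of the elements of $A$; $G$ is prime if its only modules are $\emptyset$, the singletons and $V$. A hereditary class is minimal prime if it contains infinitely many prime graphs (up to isomorphism), while every proper hereditary subclass contains only finitely many. *)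

(* Defs.v *)
From mathcomp Require Import all_boot.
From mathcomp Require Import boolp classical_sets functions cardinality.

Set Implicit Arguments.
Unset Strict Implicit.
Unset Printing Implicit Defensive.

Local Open Scope classical_set_scope.

Record graph (V : Type) := Graph {
  edge : rel V;
  edge_sym : symmetric edge;
  edge_irr : irreflexive edge }.

Section Graphs.
Variable V : Type.
Implicit Types (G : graph V) (A : set V).

(* The subset [A] coerces to the subtype of its elements. *)
Definition induced G A : graph A :=
  @Graph A (fun x y => edge G (val x) (val y))
    (fun x y => edge_sym G (val x) (val y))
    (fun x => edge_irr G (val x)).

Definition graph_iso (W : Type) G (H : graph W) : Prop :=
  exists2 f : V -> W, bijective f & forall x y, edge H (f x) (f y) = edge G x y.

Definition is_module G A : Prop :=
  forall x, ~ A x ->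
    (forall y, A y -> edge G x y) \/ (forall y, A y -> ~~ edge G x y).

(* In particular every graph with at most two vertices is prime. *)
Definition prime_graph G : Prop :=
  forall A, is_module G A -> [\/ A = set0, exists x, A = [set x] | A = setT].

Definition total_order (le : rel V) : Prop :=
  [/\ reflexive le, antisymmetric le, transitive le & total le].

Definition permutation_graph G : Prop :=
  exists (le : rel V) (sigma : V -> V),
    let lt x y := le x y && ~~ le y x in
    [/\ total_order le, bijective sigma &
        forall x y, edge G x y =
          (lt x y && lt (sigma y) (sigma x)) || (lt y x && lt (sigma x) (sigma y))].

End Graphs.

Definition embeds (V W : Type) (G : graph V) (H : graph W) : Prop :=
  exists A : set W, graph_iso G (induced H A).

(* Every finite graph is isomorphic to one on some ['I_n], so a class of finite
   graphs up to isomorphism is an isomorphism-invariant [set fin_graph]; ages and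
   hereditary classes are isomorphism-invariant, and two of them are the same
   class iff they are equal as sets. *)
Record fin_graph := FinGraph {
  graph_order : nat;
  graph_of :> graph 'I_graph_order }.

Definition Age (V : Type) (G : graph V) : set fin_graph :=
  [set H : fin_graph | embeds H G].

Definition is_age (C : set fin_graph) : Prop :=
  exists (V : Type) (G : graph V), C = Age G.

Definition hereditary (C : set fin_graph) : Prop :=
  forall G H : fin_graph, C H -> embeds G H -> C G.

Definition iso_class (G : fin_graph) : set fin_graph :=
  [set H : fin_graph | graph_iso G H].

Definition prime_iso_classes (C : set fin_graph) : set (set fin_graph) :=
  [set iso_class G | G in [set G : fin_graph | C G /\ prime_graph G]].

Definition minimal_prime (C : set fin_graph) : Prop :=
  [/\ hereditary C,
      infinite_set (prime_iso_classes C) &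
      forall D : set fin_graph, hereditary D -> D `<` C ->
        finite_set (prime_iso_classes D)].

(* Main.v *)
Require Import Defs.
From mathcomp Require Import all_boot.
From mathcomp Require Import zify.
From mathcomp Require Import boolp classical_sets functions cardinality.

(** A word [mu] over two letters is turned into a graph on the natural numbers
    by adding the vertices one at a time: the new vertex [j] is joined to all
    earlier vertices if the letter [mu j] is [true] and to none of them
    otherwise, except that [j.-1] is treated the opposite way.  So [j]
    separates [j.-1] from all the other earlier vertices, and does not separate
    these from one another.  The ages of these graphs, for recurrent words in
    which both letters occur, are minimal prime, and there are continuum many of
    them.

    Prime graphs occur: a module containing two vertices contains the next one
    after any of its vertices but the least, hence a final segment; if it misses
    a vertex, the letters along that segment are constant.  When every window of
    length [L] shows both letters this is impossible in a long prefix
    ([prefix_graph_prime]).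

    Few prime graphs occur: if an induced subgraph skips the vertex [g], the
    vertices of the subgraph below [g] form a module.  So a prime induced
    subgraph is an interval with at most one more vertex below it
    ([prime_window]).  If each prefix of [mu] recurs with bounded gaps, a large
    prime graph of the age therefore contains any given prefix graph, and with
    it any given member of the age.  A hereditary subclass that misses a member
    thus contains no large prime graph ([minimal_prime_word]).

    The age determines the word up to factors ([Age_factors]): an embedding of a
    prefix graph of [mu] into the graph of [nu] sends, after a bounded number of
    vertices, consecutive vertices to consecutive vertices.  A new vertex placed
    below earlier images would see nearly all of them through the letters of a
    long window of [nu], whereas it has to see all but one of them alike.

    Continuum many words are supplied by Toeplitz words, whose letter at [n]
    only depends on the 2-adic valuation of [n]: adding a large power of 2 to
    [n] does not change the letter, so they are recurrent.  If the sequence of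
    letters indexed by the valuation has bounded runs, the factors determine it
    ([code_word_factors]).

    All the graphs are permutation graphs because the construction can be
    drawn as a pin sequence in the plane ([word_edge_pins]).  Conversely a class
    of finite graphs is a subset of a countable type, which bounds the number
    of classes by the continuum; Cantor and Bernstein conclude. *)

Set Implicit Arguments.
Unset Strict Implicit.
Unset Printing Implicit Defensive.

Local Open Scope classical_set_scope.
Local Open Scope card_scope.

(** * Embeddings *)

Definition embedding (V W : Type) (G : graph V) (H : graph W) (f : V -> W) :=
  injective f /\ forall x y, edge H (f x) (f y) = edge G x y.

Lemma embedsP (V W : Type) (G : graph V) (H : graph W) :
  embeds G H <-> exists f, embedding G H f.
Proof.
split=> [[A [f fbij fE]]|[f [fI fE]]].
  exists (fun x => val (f x)); split=> [x y /val_inj|]; last exact: fE.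
  exact: bij_inj.
have fA x : f x \in range f by apply/mem_set; exists x.
pose F x : range f := exist _ (f x) (fA x).
exists (range f), F; last exact: fE.
have inv (z : range f) : {x | f x = val z}.
  by apply: cid; case: (set_mem (valP z)) => x _ <-; exists x.
exists (fun z => sval (inv z)) => [x|z].
  by apply: fI; rewrite (svalP (inv (F x))).
by apply: val_inj; exact: (svalP (inv z)).
Qed.

Lemma embedding_trans (U V W : Type) (G : graph U) (H : graph V) (K : graph W)
    f g : embedding G H f -> embedding H K g -> embedding G K (g \o f).
Proof.
move=> [fI fE] [gI gE]; split; first exact: inj_comp.
by move=> x y /=; rewrite gE fE.
Qed.

Lemma Age_hereditary (V : Type) (G : graph V) : hereditary (Age G).
Proof.
move=> H K /embedsP[f Hf] /embedsP[g Hg]; apply/embedsP.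
by exists (f \o g); exact: embedding_trans Hg Hf.
Qed.

(** * The graph of a word *)

Definition word_edge (mu : nat -> bool) (i j : nat) : bool :=
  (i < j) && (mu j (+) (i.+1 == j)) || (j < i) && (mu i (+) (j.+1 == i)).

Lemma word_edge_sym mu : symmetric (word_edge mu).
Proof. by move=> i j; rewrite /word_edge orbC. Qed.

Lemma word_edge_irr mu : irreflexive (word_edge mu).
Proof. by move=> i; rewrite /word_edge ltnn. Qed.

Definition word_graph mu : graph nat :=
  Graph (@word_edge_sym mu) (@word_edge_irr mu).

Definition prefix_graph mu n : fin_graph :=
  @FinGraph n (@Graph 'I_n (fun i j => word_edge mu i j)
    (fun i j => word_edge_sym mu i j) (fun i => word_edge_irr mu i)).

Lemma word_edge_next mu i : word_edge mu i i.+1 = ~~ mu i.+1.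
Proof. by rewrite /word_edge ltnSn eqxx ltnNge leqnSn orbF addbT. Qed.

Lemma word_edge_far mu i j : i.+1 < j -> word_edge mu i j = mu j.
Proof.
move=> ij; rewrite /word_edge (ltnW ij) (ltn_eqF ij) ltnNge (ltnW (ltnW ij)).
by rewrite orbF addbF.
Qed.

Lemma prefix_graph_Age mu n : Age (word_graph mu) (prefix_graph mu n).
Proof. by apply/embedsP; exists val; split=> //; exact: val_inj. Qed.

(** * Primality of long prefixes *)

Definition frequent_letters (mu : nat -> bool) L :=
  forall a c, exists2 i, a < i <= a + L & mu i = c.

(** Two vertices [i < j] of a module [M] force [j.+1] into [M], since [j.+1]
    separates them; so [M] contains all of [[j, n]].  A vertex outside [M] lies
    below [j] and reads the letters of this segment, which must be constant: [j]
    is close to [n].  Hence all elements of [M] but the least one [m] are close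
    to [n], and the other vertices see [m] and [n] alike.  This fails for one of
    [m.-1] and [m.-2] if these exist, and otherwise makes the word constant on a
    long stretch. *)
Lemma prefix_graph_prime mu L n : frequent_letters mu L -> L.*2 + 5 <= n ->
  prime_graph (prefix_graph mu n).
Proof.
move=> muL; case: n => [|n] Ln; first lia.
(* [M] is [A] transported to natural numbers, where the order lives. *)
move=> A modA; pose M k := exists2 x : 'I_n.+1, A x & val x = k.
have MA (x : 'I_n.+1) : M x -> A x by case=> y Ay /val_inj<-.
have M_le k : M k -> k <= n by case=> y _ <-; exact: (ltn_ord y).
have modM x : x <= n -> ~ M x ->
    exists c, forall y, M y -> word_edge mu x y = c.
  move=> xn Mx; have val_x : (inord x : 'I_n.+1) = x :> nat by rewrite inordK.
  have Ax : ~ A (inord x) by move=> Ax; apply: Mx; exists (inord x).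
  have [e|e] := modA (inord x) Ax.
    by exists true => _ [y Ay <-]; have /= := e y Ay; rewrite val_x.
  by exists false => _ [y Ay <-]; have /= := e y Ay; rewrite val_x => /negbTE.
have eqM x y z : x <= n -> ~ M x -> M y -> M z ->
    word_edge mu x y = word_edge mu x z.
  by move=> xn Mx My Mz; have [c e] := modM x xn Mx; rewrite !e.
have M_up i j : M i -> M j -> i < j -> forall k, j <= k <= n -> M k.
  move=> Mi Mj ij; elim=> [|k IH]; first lia.
  rewrite leq_eqVlt => /andP[/orP[/eqP<- //|jk] kn].
  have Mk : M k by apply: IH; lia.
  apply: contrapT => Mk1; have := eqM k.+1 i k kn Mk1 Mi Mk.
  rewrite ![word_edge mu k.+1 _]word_edge_sym word_edge_next word_edge_far //.
    by case: (mu _).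
  lia.
have [[x0 x0n Mx0]|Mall] :=
    pselect (exists2 x, x <= n & ~ M x); last first.
  apply: Or33; apply/seteqP; split=> // x _; apply: MA.
  by apply: contrapT => Mx; apply: Mall; exists x => //; exact: leq_ord.
have [[i [j [Mi Mj ij]]]|Mtriv] :=
    pselect (exists i j, [/\ M i, M j & i < j]); last first.
  have [->|/set0P[x Ax]] := eqVneq A set0; first exact: Or31.
  apply: Or32; exists x; apply/seteqP; split=> [y Ay|_ -> //].
  apply: val_inj; have Mx : M x by exists x.
  have My : M y by exists y.
  by have [xy|yx|//] := ltngtP (val y) (val x);
    exfalso; apply: Mtriv; [exists y, x | exists x, y].
exfalso.
(* Beyond [k] the missing vertex [x0] would read constant letters. *)
have above j' k : M j' -> M k -> j' < k -> n < k + L.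
  move=> Mj' Mk jk; rewrite ltnNge; apply/negP => kL.
  have x0k : x0 < k.
    rewrite ltnNge; apply/negP => kx; apply: Mx0.
    by apply: (M_up _ _ Mj' Mk jk); rewrite kx.
  have [y y_k muy] := muL k true; have [z z_k muz] := muL k false.
  have Mtop t : k < t <= k + L -> M t.
    by move=> tk; apply: (M_up _ _ Mj' Mk jk); lia.
  have := eqM x0 y z x0n Mx0 (Mtop _ y_k) (Mtop _ z_k).
  by rewrite !word_edge_far ?muy ?muz //; lia.
have Mn : M n by apply: (M_up _ _ Mi Mj ij); rewrite (M_le _ Mj) leqnn.
have exM : exists k, `[< M k >] by exists i; apply/asboolP.
case: (ex_minnP exM) => m /asboolP Mm m_min {exM}.
have {}m_min k : M k -> m <= k by move=> Mk; apply: m_min; apply/asboolP.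
have mn : m < n by rewrite (leq_ltn_trans (m_min _ Mi)) // (leq_trans ij) ?M_le.
have low x : x + L <= n -> x != m -> ~ M x.
  move=> xL xm Mx; have := above m x Mm Mx; have := m_min x Mx; lia.
(* [m.-1] sees [m] through [~~ mu m], [m.-2] sees it through [mu m], and both
   see [n] through [mu n]. *)
have [m2|m1] := leqP 2 m.
  have [k mk] : exists k, m = k.+2 by exists m.-2; lia.
  have nM t : t < k.+2 -> ~ M t by rewrite -mk => tm /m_min; lia.
  rewrite mk in Mm mn.
  have /(_ (ltnW (ltnW mn))) := eqM k.+1 k.+2 n _ (nM _ (leqnn _)) Mm Mn.
  have /(_ (ltnW (ltnW (ltnW mn)))) :=
    eqM k k.+2 n _ (nM _ (leqW (leqnn _))) Mm Mn.
  rewrite word_edge_next !word_edge_far //; last exact: ltnW.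
  by move=> ->; case: (mu n).
have L2 : 1 < L.
  have [y y_L muy] := muL 0 true; have [z z_L muz] := muL 0 false.
  have : y != z by apply/eqP => yz; rewrite yz muz in muy.
  lia.
have const x : m.+1 < x -> x + L <= n -> mu x = mu n.
  move=> mx xL; have xm : x != m by lia.
  have := eqM x m n ltac:(lia) (low x xL xm) Mm Mn.
  by rewrite [word_edge mu x m]word_edge_sym !word_edge_far; lia.
have [y y_m muy] := muL m.+1 (~~ mu n).
have := const y ltac:(lia) ltac:(lia).
by rewrite muy; case: (mu n).
Qed.

(** * Prime induced subgraphs are nearly intervals *)

(** A vertex above a skipped position [g] is never the successor of a vertex
    below [g], so it sees all of these alike: they form a module, which in a
    prime graph cannot have two elements and a nonempty complement. *)
Lemma prime_no_gap (V : finType) (G : graph V) mu f g (x1 x2 y : V) :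
  prime_graph G -> embedding G (word_graph mu) f -> x1 != x2 ->
  f x1 < g -> f x2 < g -> g < f y -> exists z, f z = g.
Proof.
move=> primeG [_ fE] x12 x1g x2g gy; apply: contrapT => gap.
have modA : is_module G [set x | f x < g].
  move=> z /negP; rewrite -leqNgt leq_eqVlt => /orP[/eqP gz|gz].
    by exfalso; apply: gap; exists z.
  have nz w : f w < g -> edge G z w = mu (f z).
    move=> wg; rewrite edge_sym -fE /= word_edge_far //.
    exact: leq_ltn_trans wg gz.
  by case mz: (mu (f z)); [left | right] => w /nz ->; rewrite mz.
case: (primeG _ modA) => [A0|[x Ax]|AT].
- by have : [set x | f x < g] x1 by []; rewrite A0.
- have x_low w : f w < g -> w = x.
    by move=> wg; have : [set x | f x < g] w by []; rewrite Ax.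
  by rewrite (x_low x1) // (x_low x2) // eqxx in x12.
- have : [set x | f x < g] y by rewrite AT.
  by rewrite /= ltnNge (ltnW gy).
Qed.

(** The top [n] positions up to the largest vertex are all occupied: a gap
    among them would leave at least two vertices below it. *)
Lemma prime_window n (G : graph 'I_n.+1) mu f :
  prime_graph G -> embedding G (word_graph mu) f ->
  exists a, (forall x, f x < a + n) /\
    forall z, a <= z < a + n -> exists x, f x = z.
Proof.
move=> primeG fG; have [fI fE] := fG.
pose s := [seq f x | x <- enum 'I_n.+1].
have s_uniq : uniq s by rewrite map_inj_uniq ?enum_uniq.
have s_size : size s = n.+1 by rewrite size_map size_enum_ord.
have [y _ y_max] := @arg_maxnP _ ord0 xpredT f isT.
have {}y_max x : f x <= f y by exact: y_max.
have n_le : n <= f y.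
  rewrite -ltnS -s_size -(size_iota 0 (f y).+1) uniq_leq_size //.
  move=> _ /mapP[x _ ->].
  by rewrite mem_iota add0n ltnS y_max.
exists (f y - n).+1; split=> [x|z z_in].
  by rewrite addSn subnK // ltnS.
rewrite addSn subnK // ltnS in z_in.
have [zy|zy] := eqVneq z (f y); first by exists y.
apply: contrapT => gap.
(* At most one vertex lies below the gap, so the others have too little room. *)
have [x1 x1_low] : exists x1, forall x, f x < z -> x = x1.
  have [[x1 x1z]|none] := pselect (exists x, f x < z); last first.
    by exists y => x xz; exfalso; apply: none; exists x.
  exists x1 => x xz; apply/eqP; apply: contrapT => /negP xx1; apply: gap.
  by apply: (prime_no_gap (y := y) primeG fG xx1 xz x1z); lia.
have sub : {subset s <= f x1 :: iota z.+1 (f y - z)}.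
  move=> _ /mapP[x _ ->]; rewrite inE mem_iota.
  have [/x1_low->|zx] := ltnP (f x) z; first by rewrite eqxx.
  apply/orP; right; have := y_max x.
  have : f x <> z by move=> xz; apply: gap; exists x.
  lia.
have := uniq_leq_size s_uniq sub; rewrite s_size /= size_iota; lia.
Qed.

(** * Recurrent words give minimal prime ages *)

(** Every factor lies in a prefix, so that asking this of prefixes amounts to
    uniform recurrence of the word read from position 1 on. *)
Definition recurrent (mu : nat -> bool) :=
  forall m, exists N, forall a, exists2 s, a <= s < a + N &
    forall i, 0 < i <= m -> mu (s + i) = mu i.

Lemma recurrent_frequent mu : recurrent mu -> mu 1 != mu 2 ->
  exists L, frequent_letters mu L.
Proof.
move=> recmu mu12; have [N HN] := recmu 2; exists (N + 2) => a c.
have [s s_in Es] := HN a.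
have [c1|c1] := eqVneq (mu 1) c.
  by exists (s + 1); [lia | rewrite Es].
exists (s + 2); [lia | rewrite Es //].
by move: mu12 c1; case: (mu 1); case: (mu 2); case: c.
Qed.

(** An interval induces the graph of the word read along it.  A letter only
    describes edges to earlier vertices, so those after the first suffice. *)
Lemma word_edge_shift mu s m i j :
  (forall k, 0 < k <= m -> mu (s + k) = mu k) -> i <= m -> j <= m ->
  word_edge mu (s + i) (s + j) = word_edge mu i j.
Proof.
move=> smu im jm; rewrite /word_edge !ltn_add2l -!addnS !eqn_add2l.
by have [ij|ji|//] := ltngtP i j; rewrite /= smu //; lia.
Qed.

(** A large prime graph of the age contains a long interval, and in a long
    interval every prefix recurs. *)
Lemma large_prime_contains mu m : recurrent mu ->
  exists B, forall G : fin_graph,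
  prime_graph G -> B < graph_order G -> Age (word_graph mu) G ->
  embeds (prefix_graph mu m) G.
Proof.
move=> /(_ m)[N HN]; exists (N + m).+1 => -[[//|n] G] /= primeG nB.
move=> /embedsP[f fG].
have [a [_ win]] := prime_window primeG fG; have [fI fE] := fG.
have [s s_in Es] := HN a.
have pre (i : 'I_m) : {x | f x = s + i}.
  by apply: cid; apply: win; have := ltn_ord i; lia.
apply/embedsP; exists (fun i => sval (pre i)); split=> [i j ij|i j].
  have := svalP (pre i); rewrite ij (svalP (pre j)) => /addnI/esym.
  exact: val_inj.
rewrite -fE (svalP (pre i)) (svalP (pre j)) /=.
by apply: word_edge_shift Es _ _; exact: ltnW.
Qed.

Lemma Age_prefix mu (H : fin_graph) : Age (word_graph mu) H ->
  exists m, embeds H (prefix_graph mu m).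
Proof.
case: H => n H /embedsP[f [fI fE]]; pose m := (\max_x f x).+1.
have fm x : f x < m by rewrite ltnS leq_bigmax.
exists m; apply/embedsP; exists (fun x => Ordinal (fm x)); split=> [x y|x y].
  by case=> /fI.
exact: fE.
Qed.

(** * Coding finite graphs *)

Lemma graph_ext (V : Type) (G H : graph V) :
  (forall x y, edge G x y = edge H x y) -> G = H.
Proof.
case: G H => [e es ei] [e' es' ei'] /= ee.
have {}ee : e = e' by apply/funext => x; apply/funext => y; exact: ee.
subst e'; congr Graph; exact: Prop_irrelevance.
Qed.

Definition graph_code := {n : nat & {ffun 'I_n * 'I_n -> bool}}.

Section Decode.
Variables (n : nat) (e : {ffun 'I_n * 'I_n -> bool}).

(** Symmetrized and stripped of its diagonal, any matrix is an adjacency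
    matrix; this makes decoding total. *)
Definition decode_edge (x y : 'I_n) := (x != y) && (e (x, y) || e (y, x)).

Lemma decode_edge_sym : symmetric decode_edge.
Proof. by move=> x y; rewrite /decode_edge eq_sym orbC. Qed.

Lemma decode_edge_irr : irreflexive decode_edge.
Proof. by move=> x; rewrite /decode_edge eqxx. Qed.

Definition decode_ffun : fin_graph :=
  FinGraph (Graph decode_edge_sym decode_edge_irr).
End Decode.

Definition decode (c : graph_code) : fin_graph := decode_ffun (tagged c).

Lemma decode_ffunK n (G : graph 'I_n) :
  FinGraph G = decode_ffun [ffun p => edge G p.1 p.2].
Proof.
congr FinGraph; apply: graph_ext => x y /=.
rewrite /decode_edge !ffunE /= [edge G y x]edge_sym orbb.
by case: eqP => // ->; rewrite edge_irr.
Qed.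

Lemma decode_surj G : exists c, G = decode c.
Proof.
case: G => n G; exists (existT _ n [ffun p => edge G p.1 p.2]).
exact: decode_ffunK.
Qed.

Lemma finite_bounded_order B :
  finite_set [set G : fin_graph | graph_order G <= B].
Proof.
apply: (@sub_finite_set _ _ (\bigcup_(n in `I_B.+1) range (@decode_ffun n))).
  move=> [n G] /= nB; exists n => //.
  by exists [ffun p => edge G p.1 p.2] => //; rewrite decode_ffunK.
by apply: bigcup_finite => // n _; apply: finite_image; exact: finite_finset.
Qed.

(** * Minimality *)

Lemma card_ge_injective (T U : Type) (A : set U) (f : T -> U) :
  injective f -> (forall x, A (f x)) -> [set: T] #<= A.
Proof.
move=> fI fA; apply: card_le_trans (_ : f @^-1` A #<= A).
  by apply: subset_card_le => x _; exact: fA.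
by apply: card_ge_preimage => x y _ _; exact: fI.
Qed.

Lemma graph_iso_refl (V : Type) (G : graph V) : graph_iso G G.
Proof. by exists id => //; exists id. Qed.

Lemma graph_iso_order (G H : fin_graph) :
  graph_iso G H -> graph_order G = graph_order H.
Proof. by case=> f /bij_eq_card; rewrite !card_ord. Qed.

Lemma infinite_primes mu L : frequent_letters mu L ->
  infinite_set (prime_iso_classes (Age (word_graph mu))).
Proof.
move=> muL; apply/infiniteP.
apply: (@card_ge_injective _ _ _
  (fun n => iso_class (prefix_graph mu (n + (L.*2 + 5))))) => [m n mn|n].
  have : iso_class (prefix_graph mu (n + (L.*2 + 5)))
                   (prefix_graph mu (n + (L.*2 + 5))) by exact: graph_iso_refl.
  by rewrite -mn => /graph_iso_order /= /addIn.
eexists; last by [].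
by split; [exact: prefix_graph_Age | apply: prefix_graph_prime muL _; lia].
Qed.

(** A member [H] of the age that [D] misses lies in some prefix graph, which
    would be contained in every large prime graph of [D]. *)
Lemma minimal_prime_word mu L : recurrent mu -> frequent_letters mu L ->
  minimal_prime (Age (word_graph mu)).
Proof.
move=> recmu muL; split; [exact: Age_hereditary | exact: infinite_primes muL|].
move=> D herD [DC /existsNP[H /not_implyP[CH DH]]].
have [m Hm] := Age_prefix CH.
have [B HB] := large_prime_contains m recmu.
apply: (@sub_finite_set _ _ (iso_class @` [set G | graph_order G <= B]));
  last first.
  exact/finite_image/finite_bounded_order.
move=> _ [G [DG primeG] <-]; exists G => //=; rewrite leqNgt; apply/negP => BG.
have mG := HB G primeG BG (DC G DG).
by apply: DH; exact: herD (herD _ _ DG mG) Hm.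
Qed.

(** * The age determines the factors of the word *)

(** Beyond a bound [K] an embedding of a long prefix graph is an increasing map
    with consecutive values, so it shifts positions by a constant; the letters
    are then read off the edges to the image of the vertex 0.  Placing the
    window of length [m] beyond [K] uses the recurrence of [mu]. *)
Lemma Age_factors mu nu : recurrent mu -> recurrent nu ->
  mu 1 != mu 2 -> nu 1 != nu 2 ->
  Age (word_graph mu) `<=` Age (word_graph nu) ->
  forall m, exists s, forall i, 0 < i <= m -> nu (s + i) = mu i.
Proof.
move=> recmu recnu mu12 nu12 sub m.
have [L muL] := recurrent_frequent recmu mu12.
have [L' nuL] := recurrent_frequent recnu nu12.
pose K := (L + L').*2 + 5; have [N HN] := recmu m.
have [s s_in Es] := HN K.
pose n := (s + m).+1.
have [f [fI fE]] : exists f, embedding (prefix_graph mu n) (word_graph nu) f.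
  by apply/embedsP/sub/prefix_graph_Age.
pose g k := f (inord k : 'I_n).
have gE i j : i < n -> j < n -> word_edge nu (g i) (g j) = word_edge mu i j.
  by move=> i_n j_n; rewrite [LHS]fE /= !inordK.
have gI i j : i < n -> j < n -> g i = g j -> i = j.
  by move=> i_n j_n /fI/(congr1 val); rewrite /= !inordK.
have primeK k : K <= k -> prime_graph (prefix_graph mu k).
  by move=> Kk; apply: prefix_graph_prime muL _; lia.
have g_emb k : k <= n ->
    embedding (prefix_graph mu k) (word_graph nu) (fun x => g (val x)).
  move=> kn; have lt_n (x : 'I_k) : val x < n := leq_trans (ltn_ord x) kn.
  split=> [x y /gI|x y]; last exact: gE.
  by move=> /(_ (lt_n x) (lt_n y)) /val_inj.
(* Otherwise [g k.+1] lies below the interval occupied by the images of the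
   earlier vertices, and sees a position [z] inside it through [nu z].  As
   [k.+1] sees all earlier vertices but [k] alike, the letter of [nu] opposite
   to [mu k.+1] could occur in that interval only once. *)
have g_new k j : K <= k -> k < n -> j < k -> g j < g k.
  move=> Kk kn jk; case: k => [//|k] in Kk kn jk *.
  have [a [gmax win]] := prime_window (primeK _ Kk) (g_emb _ (ltnW kn)).
  rewrite ltnNge; apply/negP => gkj.
  have ga : g k.+1 < a.
    rewrite ltnNge; apply/negP => ag.
    have [x xE] : exists x : 'I_k.+1, g x = g k.+1.
      apply: win; rewrite ag /=.
      exact: leq_ltn_trans gkj (gmax (Ordinal jk)).
    have := ltn_ord x; rewrite (gI _ _ _ kn xE) ?ltnn //.
    exact: ltn_trans (ltn_ord x) kn.
  have far z : a < z < a + k -> nu z != mu k.+1 -> z = g k.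
    move=> az nuz; have [x gx] : exists x : 'I_k.+1, g x = z by apply: win; lia.
    have [xk|xk] := eqVneq (val x) k; first by rewrite -gx xk.
    have xk' : x < k by rewrite ltn_neqAle xk -ltnS ltn_ord.
    have := gE x k.+1 (ltn_trans xk' (ltnW kn)) kn.
    rewrite gx word_edge_sym !word_edge_far //; last by lia.
    by move=> /eqP; rewrite (negbTE nuz).
  have [z1 z1_in nuz1] := nuL a (~~ mu k.+1).
  have [z2 z2_in nuz2] := nuL (a + L') (~~ mu k.+1).
  have nz b : b = ~~ mu k.+1 -> b != mu k.+1 by move=> ->; case: (mu _).
  have e1 := far z1 ltac:(lia) (nz _ nuz1).
  have e2 := far z2 ltac:(lia) (nz _ nuz2).
  lia.
(* A skipped position would have two vertices below it and one above. *)
have g_succ k : K <= k -> k.+1 < n -> g k.+1 = (g k).+1.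
  move=> Kk kn; apply/eqP; rewrite eq_sym eqn_leq; apply/andP; split.
    by apply: g_new; first exact: leqW.
  rewrite leqNgt; apply/negP => gap.
  have k0 : 0 < k by lia.
  have k1 : 1 < k by lia.
  have [x /= gx] := prime_no_gap (x1 := Ordinal (ltnW (ltnW k1) : 0 < k.+2))
    (x2 := Ordinal (ltnW (ltnW k1) : 1 < k.+2)) (y := ord_max)
    (primeK k.+2 (leqW (leqW Kk))) (g_emb k.+2 kn) isT
    (ltnW (g_new k 0 Kk (ltnW kn) k0) : _ < (g k).+1)
    (ltnW (g_new k 1 Kk (ltnW kn) k1) : _ < (g k).+1) gap.
  have x_n : x < n := leq_trans (ltn_ord x) kn.
  have xk : k < x.
    rewrite ltnNge; apply/negP; rewrite leq_eqVlt => /orP[/eqP xk|xk].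
      by rewrite xk in gx; lia.
    by have := g_new k x Kk (ltnW kn) xk; lia.
  have xk1 : x = k.+1 :> nat by have := ltn_ord x; lia.
  by rewrite xk1 in gx; lia.
have g_shift i : i <= m -> g (s + i) = g s + i.
  elim: i => [|i IH] im; first by rewrite !addn0.
  by rewrite !addnS g_succ ?IH //; lia.
exists (g s) => i i_in.
have g0s : g 0 < g s by apply: g_new; lia.
rewrite -(@word_edge_far nu (g 0)); last by lia.
rewrite -g_shift; last by lia.
rewrite gE ?word_edge_far ?Es //; lia.
Qed.

(** * Toeplitz words *)

Definition toeplitz (b : nat -> bool) (n : nat) : bool := b (logn 2 n).

Lemma logn2_shift s k : 0 < s -> logn 2 s < k -> logn 2 (s + 2 ^ k) = logn 2 s.
Proof.
move=> s0 sk; have [m odd_m sE] := pfactor_coprime (isT : prime 2) s0.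
rewrite coprime2n in odd_m; set j := logn 2 s in sk sE *.
have -> : s + 2 ^ k = (m + 2 ^ (k - j)) * 2 ^ j.
  by rewrite {1}sE mulnDl -expnD subnK // ltnW.
rewrite lognM ?expn_gt0 ?addn_gt0 ?expn_gt0 ?orbT // pfactorK //.
rewrite logn_coprime ?add0n // coprime2n oddD odd_m oddX.
by rewrite subn_eq0 leqNgt sk.
Qed.

Lemma logn2_add_small n i k : 0 < i < 2 ^ k ->
  logn 2 (n * 2 ^ k + i) = logn 2 i.
Proof.
move=> /andP[i0 ik]; have ki : logn 2 i < k.
  rewrite -(ltn_exp2l _ _ (isT : 1 < 2)); apply: leq_ltn_trans ik.
  by rewrite dvdn_leq // pfactor_dvdnn.
elim: n => [|n IH]; first by rewrite mul0n.
rewrite mulSn -addnA addnC logn2_shift ?IH //.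
by rewrite addn_gt0 i0 orbT.
Qed.

(** Positions up to [m < 2 ^ m] have valuation less than [m], so the prefix of
    length [m] reappears after every multiple of [2 ^ m]. *)
Lemma toeplitz_recurrent b : recurrent (toeplitz b).
Proof.
move=> m; exists (2 ^ m).+1 => a; exists ((a %/ 2 ^ m).+1 * 2 ^ m).
  have := divn_eq a (2 ^ m); have := ltn_pmod a (expn_gt0 2 m).
  by rewrite mulSn; lia.
move=> i /andP[i0 im]; rewrite /toeplitz logn2_add_small // i0 /=.
exact: leq_ltn_trans im (ltn_expl _ _).
Qed.

(** The letters [false] and [true] inserted around each letter of [c] keep all
    runs bounded, whatever [c] is. *)
Definition interleave (c : nat -> bool) (j : nat) : bool :=
  if j %% 3 == 0 then false else if j %% 3 == 1 then true else c (j %/ 3).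

Definition code_word c := toeplitz (interleave c).

Lemma interleave_nonconstant c j v :
  exists2 i, j < i <= j + 3 & interleave c i != v.
Proof.
have three r : r < 3 -> exists2 i, j < i <= j + 3 & i %% 3 = r.
  move=> r3; exists (j + 3 - (j + 3 - r) %% 3); lia.
case: v.
  have [i i_in ir] := three 0 isT.
  by exists i => //; rewrite /interleave ir.
have [i i_in ir] := three 1 isT.
by exists i => //; rewrite /interleave ir.
Qed.

(** Suppose that a long prefix of the word of [c] occurs in that of [c'] at the
    shift [s].  If the valuation of a nonzero [s] were at most [j], then
    [s + 2 ^ i] would have the same valuation as [s] for the three values of [i]
    following [j], and [interleave c] would be constant on them.  So [2 ^ j.+1]
    divides [s], hence [s + 2 ^ j] has valuation [j], and the letters of index
    [j] agree. *)
Lemma code_word_factors c c' :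
  (forall m, exists s, forall i, 0 < i <= m ->
     code_word c' (s + i) = code_word c i) -> c = c'.
Proof.
move=> sub; have same j : interleave c j = interleave c' j.
  have [s Es] := sub (2 ^ (j + 3)).
  have {}Es i : i <= j + 3 ->
      interleave c i = interleave c' (logn 2 (s + 2 ^ i)).
    move=> ij; rewrite -[LHS](congr1 _ (pfactorK i (isT : prime 2))).
    by rewrite -[LHS]Es ?expn_gt0 ?leq_exp2l.
  rewrite Es ?leq_addr //; congr (interleave c' _).
  have [->|s0] := posnP s; first by rewrite add0n pfactorK.
  have [sj|js] := leqP (logn 2 s) j.
    have [i i_in] := interleave_nonconstant c j (interleave c' (logn 2 s)).
    have /andP[ji ij] := i_in.
    by rewrite Es // logn2_shift ?eqxx //; exact: leq_ltn_trans ji.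
  have -> : s = s %/ 2 ^ j.+1 * 2 ^ j.+1.
    by rewrite divnK // pfactor_dvdn.
  by rewrite logn2_add_small ?pfactorK // expn_gt0 ltn_exp2l ltnSn.
apply/funext => k; have := same (k * 3 + 2).
by rewrite /interleave modnMDl divnMDl //= addn0.
Qed.

Lemma code_word_age_inj : injective (fun c => Age (word_graph (code_word c))).
Proof.
move=> c c' Ecc'; apply: code_word_factors.
by apply: Age_factors; rewrite ?Ecc' //; exact: toeplitz_recurrent.
Qed.

Lemma code_word_minimal_prime c :
  minimal_prime (Age (word_graph (code_word c))).
Proof.
have rec := toeplitz_recurrent (interleave c).
have [L HL] := recurrent_frequent rec isT.
exact: minimal_prime_word HL.
Qed.

(** * Permutation graphs *)

Section Rank.
Variables (n : nat) (X : 'I_n -> nat).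

Lemma rank_lt_size x : #|[pred y | X y < X x]| < n.
Proof.
rewrite -[ltnRHS]card_ord; apply/proper_card/properP.
by split; [exact/fintype.subsetP | exists x; rewrite // inE ltnn].
Qed.

Definition rank x : 'I_n := Ordinal (rank_lt_size x).

Lemma rank_mono x y : (rank x < rank y) = (X x < X y).
Proof.
apply/idP/idP => [|xy]; last first.
  apply/proper_card/properP; split; last by exists x; rewrite !inE ?ltnn.
  by apply/fintype.subsetP => z; rewrite !inE => /ltn_trans; apply.
apply: contraLR; rewrite -!leqNgt => yx; apply: subset_leq_card.
by apply/fintype.subsetP => z; rewrite !inE => /leq_trans; apply.
Qed.

Lemma rank_inj : injective X -> injective rank.
Proof.
move=> XI x y xy; apply: XI; have [] := ltngtP (X x) (X y) => //.
  by rewrite -rank_mono xy ltnn.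
by rewrite -rank_mono xy ltnn.
Qed.
End Rank.

(** The order compares the first coordinates; [sigma] sends [x] to the vertex
    whose rank by [X] is the rank of [x] by [Y], so that comparing images under
    [sigma] by [X] compares the vertices by [Y]. *)
Lemma permutation_graph_of_coordinates n (G : graph 'I_n) (X Y : 'I_n -> nat) :
  injective X -> injective Y ->
  (forall x y, edge G x y =
     (X x < X y) && (Y y < Y x) || (X y < X x) && (Y x < Y y)) ->
  permutation_graph G.
Proof.
move=> XI YI GE; have rI := rank_inj XI.
pose sigma x := invF rI (rank Y x).
exists (fun x y => X x <= X y), sigma; split.
- split=> [x|x y|y x z|x y];
    [exact: leqnn | | exact: leq_trans | exact: leq_total].
  by rewrite -eqn_leq => /eqP/XI.
- by apply: injF_bij => x y /(can_inj (f_invF rI))/(rank_inj YI).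
have sigmaE x y : (X (sigma x) < X (sigma y)) = (Y x < Y y).
  by rewrite -rank_mono !f_invF rank_mono.
have ltE a b : (a <= b) && ~~ (b <= a) = (a < b).
  by rewrite -ltnNge andb_idl // => /ltnW.
by move=> x y; rewrite !ltE !sigmaE GE.
Qed.

(** The direction of the pin [j] along its own axis: [mu j] says whether it
    differs from the direction of the previous pin. *)
Fixpoint parity_sum (mu : nat -> bool) j :=
  if j is j'.+1 then mu j (+) parity_sum mu j' else false.

(** The pins use the two axes alternately.  Along its own axis the pin [j] is
    placed outside all earlier points, at distance [j.*2 + 5] from the origin
    [M]; along the other one it is placed at distance [j.*2 + 2] on the side of
    the pin [j.-1], so just inside that pin, whose distance is [j.*2 + 3], and
    outside all the others, whose distance is at most [j.*2 - 1].  The origin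
    [M] is chosen large so that the truncated subtraction is harmless. *)
Definition pin_coord mu M (p : bool) j :=
  if odd j == p then
    if parity_sum mu j then M + (j.*2 + 5) else M - (j.*2 + 5)
  else
    if parity_sum mu j.-1 then M + (j.*2 + 2) else M - (j.*2 + 2).

Lemma pin_coord_own mu M p i j : i < j -> j.*2 + 5 <= M -> odd j == p ->
  (pin_coord mu M p i < pin_coord mu M p j) = parity_sum mu j.
Proof.
move=> ij jM jp; rewrite /pin_coord jp.
by case: ifP; case: ifP; case: ifP; lia.
Qed.

Lemma pin_coord_cross mu M p i j : i < j -> j.*2 + 5 <= M -> odd j != p ->
  (pin_coord mu M p i < pin_coord mu M p j) =
  parity_sum mu j.-1 (+) (i.+1 == j).
Proof.
move=> ij jM jp; rewrite /pin_coord (negbTE jp).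
have [ij1|ij1] := eqVneq i.+1 j.
  subst j.
  have -> : odd i == p by move: jp => /=; case: (odd i) p => [] [].
  by case: (parity_sum _ _) => /=; lia.
by case: ifP; case: ifP; case: ifP; lia.
Qed.

Lemma pin_coord_inj mu M p i j : i.*2 + 5 <= M -> j.*2 + 5 <= M ->
  pin_coord mu M p i = pin_coord mu M p j -> i = j.
Proof.
by move=> iM jM; rewrite /pin_coord; do 4 case: ifP => ?; lia.
Qed.

(** The letter [mu j] compares the directions of the pins [j] and [j.-1], which
    are the sides on which [j] sees the earlier points along its own axis and
    along the other one, up to the exception of [j.-1]. *)
Lemma word_edge_pins mu M i j : i < j -> j.*2 + 5 <= M ->
  word_edge mu i j = (pin_coord mu M true i < pin_coord mu M true j) (+)
                     (pin_coord mu M false i < pin_coord mu M false j).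
Proof.
move=> ij jM; rewrite /word_edge ij ltnNge ltnW //= orbF.
have muE : mu j = parity_sum mu j (+) parity_sum mu j.-1.
  by case: j ij {jM} => // j _ /=; rewrite addbK.
rewrite muE; case j_odd: (odd j).
  rewrite pin_coord_own ?pin_coord_cross ?j_odd //.
  by rewrite addbA.
rewrite pin_coord_cross ?pin_coord_own ?j_odd //.
by rewrite -addbA addbC.
Qed.

Lemma Age_word_permutation mu (G : fin_graph) :
  Age (word_graph mu) G -> permutation_graph G.
Proof.
case: G => n G /embedsP[f [fI fE]] /=.
pose M := (\max_x f x).*2 + 5.
have fM x : (f x).*2 + 5 <= M by rewrite leq_add2r leq_double leq_bigmax.
have cI p : injective (fun x => pin_coord mu M p (f x)).
  by move=> x y /pin_coord_inj/fI; apply.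
apply: (permutation_graph_of_coordinates (cI true) (cI false)) => x y.
wlog xy : x y / f x <= f y => [th|].
  have [/th //|/ltnW/th yx] := leqP (f x) (f y).
  by rewrite edge_sym yx orbC.
have [->|nxy] := eqVneq x y; first by rewrite edge_irr ltnn.
have fxy : f x < f y by rewrite ltn_neqAle xy (inj_eq fI) nxy.
have ne p : pin_coord mu M p (f x) != pin_coord mu M p (f y).
  by rewrite (inj_eq (cI p)).
rewrite -fE [LHS](word_edge_pins mu fxy (fM y)).
have := ne true; case: (ltngtP (pin_coord mu M true _)) => // _ _;
by have := ne false; case: (ltngtP (pin_coord mu M false _)).
Qed.

(** * Counting *)

Lemma graph_classes_card : [set: set fin_graph] #<= [set: nat -> bool].
Proof.
pose bits (C : set fin_graph) (k : nat) : bool :=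
  if unpickle k is Some c then `[< C (decode c) >] else false.
apply: (@card_ge_injective _ _ _ bits) => // C D CD; apply/seteqP.
have CDc c : C (decode c) <-> D (decode c).
  have := congr1 (fun h => h (pickle c)) CD; rewrite /bits pickleK => e.
  by split=> /asboolP; [rewrite e | rewrite -e] => /asboolP.
by split=> G; have [c ->] := decode_surj G; case: (CDc c).
Qed.

Theorem theorem20 :
  [set C : set fin_graph |
     [/\ is_age C,
         forall G : fin_graph, C G -> permutation_graph G &
         minimal_prime C]]
  #= [set: nat -> bool].
Proof.
apply: Cantor_Bernstein.
  exact: card_le_trans (card_leT _) graph_classes_card.
apply: (card_ge_injective code_word_age_inj) => c; split.
- by exists nat, (word_graph (code_word c)).
- exact: Age_word_permutation.
- exact: code_word_minimal_prime.
Qed.
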